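(* Let $Q$ be a subset of the group $\mathrm{Aff}_+(\mathbb R)$. Then $Q$ is a Kazhdan set in $\mathrm{Aff}_+(\mathbb R)$ if and only if the set $Q_0=\{t\in\mathbb R:\ \exists\,b\in\mathbb R,\ (e^t,b)\in Q\}$ is a Kazhdan set in $\mathbb R$.
   Context: $\mathrm{Aff}_+(\mathbb R)$ is the group of orientation-preserving affine homeomorphisms of $\mathbb R$, realized as $(0,+\infty)\times\mathbb R$ with the usual topology and group law $(a,b)(a',b')=(aa',b+ab')$. For a topological group $G$, a subset $Q$ is a Kazhdan set in $G$ if there exists $\varepsilon>0$ such that every strongly continuous unitary representation $\pi$ of $G$ on a complex Hilbert space having a vector $x$ with $\sup_{g\in Q}\|\pi(g)x-x\|<\varepsilon\|x\|$ has a non-zero $G$-invariant vector. *)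

(* Defs.v *)
From Stdlib Require Import Reals Lra.
Open Scope R_scope.

Definition Cx : Type := (R * R)%type.
Definition Cre (z : Cx) : R := fst z.
Definition Cim (z : Cx) : R := snd z.
Definition C0 : Cx := (0, 0).
Definition C1 : Cx := (1, 0).
Definition Cadd (z w : Cx) : Cx := (fst z + fst w, snd z + snd w).
Definition Cmul (z w : Cx) : Cx :=
  (fst z * fst w - snd z * snd w, fst z * snd w + snd z * fst w).
Definition Cconj (z : Cx) : Cx := (fst z, - snd z).

Record CHilbert := {
  hv :> Type;
  hadd : hv -> hv -> hv;
  hzero : hv;
  hopp : hv -> hv;
  hscal : Cx -> hv -> hv;
  hinner : hv -> hv -> Cx;
  hadd_assoc : forall x y z, hadd x (hadd y z) = hadd (hadd x y) z;
  hadd_comm : forall x y, hadd x y = hadd y x;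
  hadd_0l : forall x, hadd hzero x = x;
  hadd_oppl : forall x, hadd (hopp x) x = hzero;
  hscal_1 : forall x, hscal C1 x = x;
  hscal_assoc : forall a b x, hscal a (hscal b x) = hscal (Cmul a b) x;
  hscal_addr : forall a x y, hscal a (hadd x y) = hadd (hscal a x) (hscal a y);
  hscal_addl : forall a b x, hscal (Cadd a b) x = hadd (hscal a x) (hscal b x);
  hinner_addl : forall x y z, hinner (hadd x y) z = Cadd (hinner x z) (hinner y z);
  hinner_scall : forall a x y, hinner (hscal a x) y = Cmul a (hinner x y);
  hinner_sym : forall x y, hinner y x = Cconj (hinner x y);
  hinner_pos : forall x, 0 <= Cre (hinner x x);
  hinner_def : forall x, Cre (hinner x x) = 0 -> x = hzero;
  hcomplete : forall u : nat -> hv,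
    (forall eps, 0 < eps -> exists N, forall m n, (N <= m)%nat -> (N <= n)%nat ->
        sqrt (Cre (hinner (hadd (u m) (hopp (u n))) (hadd (u m) (hopp (u n))))) < eps) ->
    exists l, forall eps, 0 < eps -> exists N, forall n, (N <= n)%nat ->
        sqrt (Cre (hinner (hadd (u n) (hopp l)) (hadd (u n) (hopp l)))) < eps
}.

Arguments hadd {c}. Arguments hzero {c}. Arguments hopp {c}.
Arguments hscal {c}. Arguments hinner {c}.

Definition hnorm {H : CHilbert} (x : H) : R := sqrt (Cre (hinner x x)).
Definition hdist {H : CHilbert} (x y : H) : R := hnorm (hadd x (hopp y)).

(* A topological group given by its carrier, law, unit, and a metric
   inducing its topology. *)
Record TopGrp := {
  tg :> Type;
  tg_mul : tg -> tg -> tg;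
  tg_one : tg;
  tg_dist : tg -> tg -> R
}.
Arguments tg_mul {t}. Arguments tg_one {t}. Arguments tg_dist {t}.

Definition unitary_rep (G : TopGrp) (H : CHilbert) (pi : G -> H -> H) : Prop :=
  (forall g x y, pi g (hadd x y) = hadd (pi g x) (pi g y)) /\
  (forall g a x, pi g (hscal a x) = hscal a (pi g x)) /\
  (forall g x y, hinner (pi g x) (pi g y) = hinner x y) /\
  (forall g y, exists x, pi g x = y) /\
  (forall g h x, pi (tg_mul g h) x = pi g (pi h x)) /\
  (forall x, pi tg_one x = x) /\
  (forall x g0 eps, 0 < eps -> exists delta, 0 < delta /\
      forall g, tg_dist g g0 < delta -> hdist (pi g x) (pi g0 x) < eps).

(* Kazhdan set.  "sup_{g in Q} ||pi g x - x|| < eps ||x||" is written as: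
   there is c >= 0 (the sup of nonnegative quantities, 0 if Q is empty)
   with c < eps ||x|| bounding all ||pi g x - x||, g in Q. *)
Definition Kazhdan_set (G : TopGrp) (Q : G -> Prop) : Prop :=
  exists eps, 0 < eps /\
    forall (H : CHilbert) (pi : G -> H -> H), unitary_rep G H pi ->
      forall x : H,
        (exists c, 0 <= c /\ c < eps * hnorm x /\
           forall g, Q g -> hdist (pi g x) x <= c) ->
        exists v : H, v <> hzero /\ forall g, pi g v = v.

Definition Radd_grp : TopGrp :=
  {| tg := R; tg_mul := Rplus; tg_one := 0; tg_dist := fun s t => Rabs (s - t) |}.

Definition Aff : Type := { p : R * R | 0 < fst p }.

Definition Aff_mul (g h : Aff) : Aff.
Proof.
  destruct g as [[a b] ha]; destruct h as [[a' b'] ha'].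
  exists (a * a', b + a * b'). simpl in *. now apply Rmult_lt_0_compat.
Defined.

Definition Aff_one : Aff.
Proof. exists (1, 0). simpl. lra. Defined.

Definition Aff_dist (g h : Aff) : R :=
  let '(a, b) := proj1_sig g in let '(a', b') := proj1_sig h in
  sqrt ((a - a') ^ 2 + (b - b') ^ 2).

Definition Aff_grp : TopGrp :=
  {| tg := Aff; tg_mul := Aff_mul; tg_one := Aff_one; tg_dist := Aff_dist |}.

Definition Q0 (Q : Aff -> Prop) (t : R) : Prop :=
  exists g : Aff, Q g /\ fst (proj1_sig g) = exp t.

(* Main.v *)
(** Kazhdan sets push forward along surjective continuous homomorphisms, which
    gives one implication through [(a, b) |-> ln a].  For the other one, let [N] be
    the translation subgroup, and split an almost invariant vector as [x = y + z]
    with [y] fixed by [N] and [z] orthogonal to the [N]-fixed vectors.  Since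
    [n_s g = g n_(s/a)] for [g = (a, b)], the vectors [g z] are asymptotically fixed
    by [N] as [a] tends to infinity (Mautner phenomenon), hence [<g z, z>] tends to
    [0] and [g] moves [z] by about [sqrt 2 * |z|].  Slow characters almost fix
    bounded sets, so a Kazhdan set [Q0] is unbounded, and [z] is small compared
    with [x]: therefore [y] is an almost invariant vector for the representation of
    [R] on the [N]-fixed vectors. *)

From Coquelicot Require Import Coquelicot.
From Stdlib Require Import Reals Lra IndefiniteDescription Classical ProofIrrelevance.
Require Import Defs.

(** * Real inner product geometry *)

Section RealInnerProduct.

Context {H : CHilbert}.
Implicit Types (x y z u v : H).

Definition rin x y : R := Cre (hinner x y).
Definition hsub x y : H := hadd x (hopp y).
Definition rscal (a : R) x : H := hscal (a, 0) x.
Definition midpoint x y : H := rscal (1 / 2) (hadd x y).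

Lemma rin_sym x y : rin x y = rin y x.
Proof. unfold rin. now rewrite (hinner_sym _ y x). Qed.

Lemma rin_addl x y z : rin (hadd x y) z = rin x z + rin y z.
Proof. unfold rin. now rewrite hinner_addl. Qed.

Lemma rin_addr x y z : rin z (hadd x y) = rin z x + rin z y.
Proof. now rewrite !(rin_sym z), rin_addl. Qed.

Lemma rin_zerol y : rin hzero y = 0.
Proof.
  assert (double := rin_addl hzero hzero y). rewrite hadd_0l in double. lra.
Qed.

Lemma rin_zeror y : rin y hzero = 0.
Proof. now rewrite rin_sym, rin_zerol. Qed.

Lemma rin_oppl x y : rin (hopp x) y = - rin x y.
Proof.
  assert (cancel := rin_addl (hopp x) x y).
  rewrite hadd_oppl, rin_zerol in cancel. lra.
Qed.

Lemma rin_subl x y z : rin (hsub x y) z = rin x z - rin y z.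
Proof. unfold hsub. rewrite rin_addl, rin_oppl. ring. Qed.

Lemma rin_subr x y z : rin z (hsub x y) = rin z x - rin z y.
Proof. now rewrite !(rin_sym z), rin_subl. Qed.

Lemma rin_rscall a x y : rin (rscal a x) y = a * rin x y.
Proof. unfold rin, rscal. rewrite hinner_scall. unfold Cre, Cmul; simpl. ring. Qed.

Lemma rin_midpointl x y z : rin (midpoint x y) z = (rin x z + rin y z) / 2.
Proof. unfold midpoint. rewrite rin_rscall, rin_addl. field. Qed.

Lemma rin_midpointr x y z : rin z (midpoint x y) = (rin z x + rin z y) / 2.
Proof. now rewrite !(rin_sym z), rin_midpointl. Qed.

Lemma rin_ge0 x : 0 <= rin x x.
Proof. apply hinner_pos. Qed.

Lemma hsub_eq0 x y : hsub x y = hzero -> x = y.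
Proof.
  intros xy0. rewrite <- (hadd_0l _ y), <- xy0. unfold hsub.
  now rewrite <- hadd_assoc, hadd_oppl, hadd_comm, hadd_0l.
Qed.

Lemma rin_inj x y : (forall v, rin x v = rin y v) -> x = y.
Proof.
  intros same. apply hsub_eq0, hinner_def.
  change (rin (hsub x y) (hsub x y) = 0). rewrite rin_subl, same. ring.
Qed.

Lemma hnorm_ge0 x : 0 <= hnorm x.
Proof. apply sqrt_pos. Qed.

Lemma hdist_ge0 x y : 0 <= hdist x y.
Proof. apply hnorm_ge0. Qed.

Lemma hnorm_sqr x : (hnorm x)² = rin x x.
Proof. apply Rsqr_sqrt, hinner_pos. Qed.

Lemma hdist_sqr x y : (hdist x y)² = rin x x - 2 * rin x y + rin y y.
Proof.
  change ((hnorm (hsub x y))² = rin x x - 2 * rin x y + rin y y).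
  rewrite hnorm_sqr, rin_subl, !rin_subr, (rin_sym y x). ring.
Qed.

Lemma hdist_eq0 x y : hdist x y = 0 -> x = y.
Proof.
  intros dist0. apply hsub_eq0, hinner_def.
  change (rin (hsub x y) (hsub x y) = 0).
  rewrite <- hnorm_sqr. change ((hdist x y)² = 0). rewrite dist0. apply Rsqr_0.
Qed.

Lemma cauchy_schwarz x y : Rabs (rin x y) <= hnorm x * hnorm y.
Proof.
  apply Rsqr_incr_0_var; [|apply Rmult_le_pos; apply hnorm_ge0].
  rewrite <- Rsqr_abs, Rsqr_mult, !hnorm_sqr.
  assert (gram := rin_ge0 (hsub (rscal (rin y y) x) (rscal (rin x y) y))).
  rewrite rin_subl, !rin_subr, !rin_rscall, !(rin_sym _ (rscal _ _)), !rin_rscall,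
    (rin_sym y x) in gram.
  destruct (Rle_lt_or_eq_dec _ _ (rin_ge0 y)) as [pos | null].
  - apply Rmult_le_reg_l with (1 := pos). unfold Rsqr. nra.
  - symmetry in null. apply hinner_def in null. subst y.
    rewrite !rin_zeror. unfold Rsqr. lra.
Qed.

Lemma rin_sub_le u x y : Rabs (rin u x - rin u y) <= hnorm u * hdist x y.
Proof. rewrite <- rin_subr. apply cauchy_schwarz. Qed.

Lemma pythagoras x y : rin x y = 0 -> rin (hadd x y) (hadd x y) = rin x x + rin y y.
Proof. intros orth. rewrite rin_addl, !rin_addr, (rin_sym y x). lra. Qed.

Lemma parallelogram_midpoint x y :
  (hdist x y)² = 2 * rin x x + 2 * rin y y - 4 * rin (midpoint x y) (midpoint x y).
Proof.
  rewrite hdist_sqr, rin_midpointl, !rin_midpointr, (rin_sym y x). field.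
Qed.

End RealInnerProduct.

(** * Limits and closed sets *)

Lemma is_lim_seq_0_dominated (a b : nat -> R) :
  (forall n, Rabs (a n) <= b n) -> is_lim_seq b 0 -> is_lim_seq a 0.
Proof.
  intros le_ab lim_b. apply is_lim_seq_abs_0.
  apply is_lim_seq_le_le with (fun _ => 0) b; auto using is_lim_seq_const.
  intros n. split; [apply Rabs_pos | apply le_ab].
Qed.

Lemma is_lim_seq_0_scal (K : R) (a : nat -> R) :
  is_lim_seq a 0 -> is_lim_seq (fun n => K * a n) 0.
Proof.
  intros lim_a. rewrite <- (Rmult_0_r K). exact (is_lim_seq_scal_l a K 0 lim_a).
Qed.

Lemma is_lim_seq_sub_0 (a : nat -> R) (l : R) :
  is_lim_seq (fun n => a n - l) 0 -> is_lim_seq a l.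
Proof.
  intros lim. apply is_lim_seq_ext with (fun n => a n - l + l); [intros n; ring|].
  replace (Finite l) with (Finite (0 + l)) by (f_equal; ring).
  apply is_lim_seq_plus'; auto using is_lim_seq_const.
Qed.

Lemma is_lim_seq_real_unique (a : nat -> R) (l m : R) :
  is_lim_seq a l -> is_lim_seq a m -> l = m.
Proof.
  intros lim_l lim_m. apply is_lim_seq_unique in lim_l, lim_m. congruence.
Qed.

Lemma minimizing_sequence {T : Type} (S : T -> Prop) (f : T -> R) (m : R) :
  (exists w, S w) -> (forall w, S w -> m <= f w) ->
  exists (d : R) (u : nat -> T), (forall w, S w -> d <= f w) /\
    (forall n, S (u n)) /\ is_lim_seq (fun n => f (u n)) d.
Proof.
  intros [w0 Sw0] lower.
  destruct (completeness (fun r => exists w, S w /\ r = - f w)) as [s [ub lub]].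
  { exists (- m). intros r (w & Sw & ->). specialize (lower w Sw). lra. }
  { exists (- f w0), w0. auto. }
  assert (inf : forall w, S w -> - s <= f w).
  { intros w Sw. assert (- f w <= s) by (apply ub; eauto). lra. }
  assert (approx : forall n, exists w, S w /\ f w <= - s + RinvN n).
  { intros n. apply NNPP. intros none. assert (pos := cond_pos (RinvN n)).
    assert (s <= s - RinvN n); [|lra].
    apply lub. intros r (w & Sw & ->).
    destruct (Rle_lt_dec (f w) (- s + RinvN n)); [|lra]. exfalso; eauto. }
  apply functional_choice in approx as [u u_spec].
  exists (- s), u. split; [exact inf|]. split; [apply u_spec|].
  apply is_lim_seq_le_le with (fun _ => - s) (fun n => - s + RinvN n).
  - intros n. split; [apply inf, u_spec | apply u_spec].
  - apply is_lim_seq_const.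
  - apply is_lim_seq_sub_0.
    apply is_lim_seq_ext with (2 := proj2 (is_lim_seq_Reals _ 0) RinvN_cv).
    intros n. ring.
Qed.

Section ClosedSets.

Context {H : CHilbert}.
Implicit Types (u : nat -> H) (l v w x y z : H) (S : H -> Prop).

Definition hcv u l : Prop := is_lim_seq (fun n => hdist (u n) l) 0.

Lemma hcv_eps u l :
  hcv u l <-> forall eps, 0 < eps ->
    exists N, forall n, (N <= n)%nat -> hdist (u n) l < eps.
Proof.
  assert (absE : forall n, Rabs (hdist (u n) l - 0) = hdist (u n) l).
  { intros n. rewrite Rminus_0_r. apply Rabs_pos_eq, hdist_ge0. }
  unfold hcv. rewrite <- is_lim_seq_spec. split.
  - intros lim eps pos. destruct (lim (mkposreal eps pos)) as [N near].
    exists N. intros n le_Nn. rewrite <- absE. now apply near.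
  - intros lim eps. destruct (lim eps (cond_pos eps)) as [N near].
    exists N. intros n le_Nn. rewrite absE. now apply near.
Qed.

Lemma hcv_rin u l v : hcv u l -> is_lim_seq (fun n => rin v (u n)) (rin v l).
Proof.
  intros lim. apply is_lim_seq_sub_0.
  apply is_lim_seq_0_dominated with (fun n => hnorm v * hdist (u n) l).
  - intros n. apply rin_sub_le.
  - now apply is_lim_seq_0_scal.
Qed.

Lemma hcv_rin_diag u l : hcv u l -> is_lim_seq (fun n => rin (u n) (u n)) (rin l l).
Proof.
  intros lim.
  apply is_lim_seq_ext
    with (fun n => (hdist (u n) l * hdist (u n) l + 2 * rin l (u n)) - rin l l).
  { intros n. fold (hdist (u n) l)². rewrite hdist_sqr, (rin_sym l (u n)). ring. }
  replace (Finite (rin l l)) with (Finite (0 * 0 + 2 * rin l l - rin l l))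
    by (f_equal; ring).
  apply is_lim_seq_minus'; [|apply is_lim_seq_const].
  apply is_lim_seq_plus'; [now apply is_lim_seq_mult'|].
  apply is_lim_seq_mult'; [apply is_lim_seq_const | now apply hcv_rin].
Qed.

Lemma hcv_unique u l l' : hcv u l -> hcv u l' -> l = l'.
Proof.
  intros lim lim'. apply rin_inj. intros v. rewrite !(rin_sym _ v).
  apply is_lim_seq_real_unique with (fun n => rin v (u n)); now apply hcv_rin.
Qed.

Definition hclosed S : Prop :=
  forall u l, (forall n, S (u n)) -> hcv u l -> S l.

Definition midpoint_convex S : Prop :=
  forall x y, S x -> S y -> S (midpoint x y).

Lemma exists_minimal_norm S :
  (exists x, S x) -> hclosed S -> midpoint_convex S ->
  exists y, S y /\ forall w, S w -> rin y y <= rin w w.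
Proof.
  intros nonempty closed convex.
  destruct (minimizing_sequence S (fun w => rin w w) 0) as (d & u & inf & Su & lim_d).
  { exact nonempty. }
  { intros w _. apply rin_ge0. }
  destruct (hcomplete H u) as [y lim_y].
  { intros eps pos.
    assert (pos' : 0 < eps * eps / 4) by nra.
    apply is_lim_seq_spec in lim_d.
    destruct (lim_d (mkposreal _ pos')) as [N near]. simpl in near.
    exists N. intros p q le_Np le_Nq. change (hdist (u p) (u q) < eps).
    apply near, Rabs_lt_between in le_Np, le_Nq.
    assert (law := parallelogram_midpoint (u p) (u q)).
    assert (low := inf _ (convex _ _ (Su p) (Su q))).
    apply Rsqr_incrst_0; [unfold Rsqr at 2; lra | apply hdist_ge0 | lra]. }
  apply (proj2 (hcv_eps u y)) in lim_y.
  exists y. split; [exact (closed u y Su lim_y)|].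
  rewrite (is_lim_seq_real_unique _ _ _ (hcv_rin_diag u y lim_y) lim_d).
  exact inf.
Qed.

Lemma minimal_norm_unique S y w :
  midpoint_convex S -> (forall v, S v -> rin y y <= rin v v) ->
  S y -> S w -> rin w w = rin y y -> w = y.
Proof.
  intros convex minimal Sy Sw same. specialize (minimal _ (convex _ _ Sw Sy)).
  apply hdist_eq0, Rsqr_0_uniq, Rle_antisym; [|apply Rle_0_sqr].
  rewrite parallelogram_midpoint. lra.
Qed.

(* The smallest closed midpoint-convex set containing [S], given by its induction
   principle. *)
Definition closed_hull S y : Prop :=
  forall T, hclosed T -> midpoint_convex T -> (forall x, S x -> T x) -> T y.

Lemma closed_hull_incl S x : S x -> closed_hull S x.
Proof. intros Sx T _ _ incl. now apply incl. Qed.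

Lemma closed_hull_closed S : hclosed (closed_hull S).
Proof.
  intros u l hull_u lim T closed convex incl. apply (closed u l); [|exact lim].
  intros n. now apply hull_u.
Qed.

Lemma closed_hull_convex S : midpoint_convex (closed_hull S).
Proof.
  intros x y hx hy T closed convex incl. apply convex; [apply hx | apply hy]; auto.
Qed.

Lemma rin_level_closed (r : R) v : hclosed (fun w => rin v w = r).
Proof.
  intros u l level lim. apply is_lim_seq_real_unique with (fun n => rin v (u n)).
  - now apply hcv_rin.
  - apply is_lim_seq_ext with (fun _ => r); [|apply is_lim_seq_const].
    intros n. now rewrite level.
Qed.

Lemma rin_level_convex (r : R) v : midpoint_convex (fun w => rin v w = r).
Proof. intros x y hx hy. rewrite rin_midpointr, hx, hy. field. Qed.

Definition bounded_seq u : Prop := exists K, forall k, hnorm (u k) <= K.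

Lemma weak_limit_closed u (a : nat -> R) :
  bounded_seq u -> hclosed (fun w => is_lim_seq (fun k => rin (u k) w - a k) 0).
Proof.
  intros [K bound] w l lim_w lim_l.
  assert (K_ge0 := Rle_trans _ _ _ (hnorm_ge0 (u 0%nat)) (bound 0%nat)).
  apply is_lim_seq_spec. intros [eps pos]. simpl.
  assert (pos' : 0 < eps / (2 * (K + 1))) by (apply Rdiv_lt_0_compat; lra).
  destruct (proj1 (hcv_eps w l) lim_l _ pos') as [n close].
  specialize (close n (le_n n)).
  assert (small : K * hdist (w n) l < eps / 2).
  { apply Rle_lt_trans with ((K + 1) * hdist (w n) l).
    - assert (d0 := hdist_ge0 (w n) l). lra.
    - replace (eps / 2) with ((K + 1) * (eps / (2 * (K + 1)))) by (field; lra).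
      apply Rmult_lt_compat_l; lra. }
  specialize (lim_w n). apply is_lim_seq_spec in lim_w.
  destruct (lim_w (mkposreal (eps / 2) ltac:(lra))) as [N near]. simpl in near.
  exists N. intros k le_Nk. apply near, Rabs_lt_between in le_Nk. apply Rabs_lt_between.
  assert (diff := rin_sub_le (u k) (w n) l). apply Rabs_le_between in diff.
  assert (hnorm (u k) * hdist (w n) l <= K * hdist (w n) l)
    by (apply Rmult_le_compat_r; [apply hdist_ge0 | apply bound]).
  lra.
Qed.

Lemma weak_limit_convex u (a : nat -> R) :
  midpoint_convex (fun w => is_lim_seq (fun k => rin (u k) w - a k) 0).
Proof.
  intros x y lim_x lim_y.
  apply is_lim_seq_ext with (fun k => / 2 * ((rin (u k) x - a k) + (rin (u k) y - a k))).
  { intros k. rewrite rin_midpointr. field. }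
  apply is_lim_seq_0_scal. rewrite <- (Rplus_0_l 0). now apply is_lim_seq_plus'.
Qed.

Definition orthogonal_to S z : Prop := forall v, S v -> rin z v = 0.

End ClosedSets.

(** * Closed subspaces *)

Record closed_subspace {H : CHilbert} (P : H -> Prop) : Prop := {
  closed_subspace_zero : P hzero;
  closed_subspace_add : forall x y, P x -> P y -> P (hadd x y);
  closed_subspace_scal : forall a x, P x -> P (hscal a x);
  closed_subspace_closed : hclosed P
}.

Lemma hopp_rscal {H : CHilbert} (x : H) : hopp x = rscal (-1) x.
Proof. apply rin_inj. intros v. rewrite rin_oppl, rin_rscall. ring. Qed.

Lemma closed_subspace_opp {H : CHilbert} (P : H -> Prop) (x : H) :
  closed_subspace P -> P x -> P (hopp x).
Proof. intros sub Px. rewrite hopp_rscal. now apply (closed_subspace_scal P). Qed.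

Lemma proj1_sig_inj {A : Type} (P : A -> Prop) (x y : {a : A | P a}) :
  proj1_sig x = proj1_sig y -> x = y.
Proof. apply eq_sig_hprop. intros; apply proof_irrelevance. Qed.

Definition subspace {H : CHilbert} (P : H -> Prop) (sub : closed_subspace P) : CHilbert.
Proof.
  unshelve refine
   {| hv := {v : H | P v};
      hadd := fun x y => exist _ (hadd (proj1_sig x) (proj1_sig y))
        (closed_subspace_add P sub _ _ (proj2_sig x) (proj2_sig y));
      hzero := exist _ hzero (closed_subspace_zero P sub);
      hopp := fun x => exist _ (hopp (proj1_sig x))
        (closed_subspace_opp P _ sub (proj2_sig x));
      hscal := fun a x => exist _ (hscal a (proj1_sig x))
        (closed_subspace_scal P sub a _ (proj2_sig x));
      hinner := fun x y => hinner (proj1_sig x) (proj1_sig y) |};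
    try (intros; apply proj1_sig_inj).
  - apply hadd_assoc.
  - apply hadd_comm.
  - apply hadd_0l.
  - apply hadd_oppl.
  - apply hscal_1.
  - apply hscal_assoc.
  - apply hscal_addr.
  - apply hscal_addl.
  - intros; apply hinner_addl.
  - intros; apply hinner_scall.
  - intros; apply hinner_sym.
  - intros; apply hinner_pos.
  - now apply hinner_def.
  - intros u cauchy. destruct (hcomplete H (fun n => proj1_sig (u n)) cauchy) as [l lim].
    assert (Pl : P l).
    { apply (closed_subspace_closed P sub (fun n => proj1_sig (u n))).
      - intros n. apply proj2_sig.
      - now apply hcv_eps. }
    exists (exist _ l Pl). exact lim.
Defined.

(** * Unitary representations *)

Section Action.

Context {G : TopGrp} {H : CHilbert}.
Variables (pi : G -> H -> H) (N : G -> Prop).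

Definition subsemigroup : Prop :=
  (exists n, N n) /\ forall n m, N n -> N m -> N (tg_mul n m).

Definition normal_set : Prop :=
  forall g n, N n -> exists n', N n' /\ tg_mul n g = tg_mul g n'.

Definition fixed_by (v : H) : Prop := forall n, N n -> pi n v = v.

Definition orbit (x w : H) : Prop := exists n, N n /\ w = pi n x.

Definition asymptotically_fixed_by (u : nat -> H) : Prop :=
  forall n, N n -> is_lim_seq (fun k => hdist (pi n (u k)) (u k)) 0.

End Action.

Section UnitaryRepresentation.

Context {G : TopGrp} {H : CHilbert} {pi : G -> H -> H}.
Hypothesis rep : unitary_rep G H pi.
Implicit Types (g h n : G) (x y z v w : H) (N : G -> Prop).

Lemma act_add g x y : pi g (hadd x y) = hadd (pi g x) (pi g y).
Proof. apply rep. Qed.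

Lemma act_scal g a x : pi g (hscal a x) = hscal a (pi g x).
Proof. apply rep. Qed.

Lemma act_mul g h x : pi (tg_mul g h) x = pi g (pi h x).
Proof. apply rep. Qed.

Lemma act_one x : pi tg_one x = x.
Proof. apply rep. Qed.

Lemma act_rin g x y : rin (pi g x) (pi g y) = rin x y.
Proof. unfold rin. f_equal. apply rep. Qed.

Lemma act_zero g : pi g hzero = hzero.
Proof.
  apply rin_inj. intros v. assert (double := act_add g hzero hzero).
  rewrite hadd_0l in double. apply (f_equal (fun w => rin w v)) in double.
  rewrite rin_addl in double. rewrite rin_zerol. lra.
Qed.

Lemma act_midpoint g x y : pi g (midpoint x y) = midpoint (pi g x) (pi g y).
Proof. unfold midpoint, rscal. now rewrite act_scal, act_add. Qed.

Lemma act_hnorm g x : hnorm (pi g x) = hnorm x.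
Proof. unfold hnorm. f_equal. apply act_rin. Qed.

Lemma act_hdist g x y : hdist (pi g x) (pi g y) = hdist x y.
Proof.
  apply Rsqr_inj; try apply hdist_ge0. now rewrite !hdist_sqr, !act_rin.
Qed.

Lemma act_hcv g (u : nat -> H) l : hcv u l -> hcv (fun k => pi g (u k)) (pi g l).
Proof. apply is_lim_seq_ext. intros k. now rewrite act_hdist. Qed.

Lemma act_strongly_continuous (g : nat -> G) g0 x :
  is_lim_seq (fun k => tg_dist (g k) g0) 0 -> hcv (fun k => pi (g k) x) (pi g0 x).
Proof.
  destruct rep as (_ & _ & _ & _ & _ & _ & cont).
  intros lim. apply hcv_eps. intros eps pos.
  destruct (cont x g0 eps pos) as (delta & pos' & near).
  apply is_lim_seq_spec in lim. destruct (lim (mkposreal delta pos')) as [k0 close].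
  exists k0. intros k le_k. apply near.
  apply close, Rabs_lt_between in le_k. simpl in le_k. lra.
Qed.

Lemma displacement_sqr g x :
  (hdist (pi g x) x)² = 2 * rin x x - 2 * rin (pi g x) x.
Proof. rewrite hdist_sqr, act_rin. ring. Qed.

Lemma rin_act_inv g h x y : tg_mul g h = tg_one -> rin (pi g x) y = rin x (pi h y).
Proof.
  intros gh1. rewrite <- (act_rin g x (pi h y)), <- act_mul, gh1, act_one. reflexivity.
Qed.

Lemma fixed_by_closed_subspace N : closed_subspace (fixed_by pi N).
Proof.
  split.
  - intros n _. apply act_zero.
  - intros x y fx fy n Nn. now rewrite act_add, fx, fy.
  - intros a x fx n Nn. now rewrite act_scal, fx.
  - intros u l fu lim n Nn. apply hcv_unique with u; [|exact lim].
    apply is_lim_seq_ext with (fun k => hdist (pi n (u k)) (pi n l)).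
    + intros k. now rewrite (fu k n Nn).
    + now apply act_hcv.
Qed.

Lemma fixed_by_normal_stable N g v :
  normal_set N -> fixed_by pi N v -> fixed_by pi N (pi g v).
Proof.
  intros normal fv n Nn. destruct (normal g n Nn) as (n' & Nn' & comm).
  now rewrite <- act_mul, comm, act_mul, fv.
Qed.

Lemma closed_hull_orbit_stable N x w n :
  (forall m, N m -> N (tg_mul n m)) -> closed_hull (orbit pi N x) w ->
  closed_hull (orbit pi N x) (pi n w).
Proof.
  intros mulN hull_w T closed convex incl.
  apply (hull_w (fun v => T (pi n v))).
  - intros u l Tu lim. apply (closed (fun k => pi n (u k))); [exact Tu|].
    now apply act_hcv.
  - intros y z Ty Tz. rewrite act_midpoint. now apply convex.
  - intros v (m & Nm & ->). rewrite <- act_mul. apply incl.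
    exists (tg_mul n m). auto.
Qed.

Lemma rin_closed_hull_orbit N x w v :
  fixed_by pi N v -> closed_hull (orbit pi N x) w -> rin v w = rin v x.
Proof.
  intros fv hull_w. apply hull_w.
  - apply rin_level_closed.
  - apply rin_level_convex.
  - intros y (n & Nn & ->). rewrite <- (fv n Nn) at 1. apply act_rin.
Qed.

(* The element of minimal norm of the hull is fixed because it is unique. *)
Lemma alaoglu_birkhoff N x :
  subsemigroup N -> exists y, fixed_by pi N y /\ closed_hull (orbit pi N x) y.
Proof.
  intros [[n0 Nn0] mulN]. set (hull := closed_hull (orbit pi N x)).
  destruct (exists_minimal_norm hull) as (y & hull_y & minimal).
  - exists (pi n0 x). apply closed_hull_incl. now exists n0.
  - apply closed_hull_closed.
  - apply closed_hull_convex.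
  - exists y. split; [|exact hull_y]. intros n Nn.
    apply (minimal_norm_unique hull); auto.
    + apply closed_hull_convex.
    + apply closed_hull_orbit_stable; auto.
    + apply act_rin.
Qed.

(* [u] does not asymptotically distinguish [z] from the points of the closed hull of
   its orbit, which contains [0]. *)
Lemma asymptotically_fixed_orthogonal N (u : nat -> H) z :
  subsemigroup N -> bounded_seq u -> asymptotically_fixed_by pi N u ->
  orthogonal_to (fixed_by pi N) z -> is_lim_seq (fun k => rin (u k) z) 0.
Proof.
  intros semigroup bound asym orth.
  destruct (alaoglu_birkhoff N z semigroup) as (y & fy & hull_y).
  assert (y0 : y = hzero).
  { apply hinner_def. change (rin y y = 0).
    rewrite (rin_closed_hull_orbit N z y y fy hull_y), rin_sym. now apply orth. }
  assert (lim_y : is_lim_seq (fun k => rin (u k) y - rin (u k) z) 0).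
  { apply hull_y.
    - now apply weak_limit_closed.
    - apply weak_limit_convex.
    - intros w (n & Nn & ->).
      apply is_lim_seq_0_dominated
        with (fun k => hnorm (pi n z) * hdist (pi n (u k)) (u k)).
      + intros k. rewrite <- (act_rin n (u k) z), !(rin_sym _ (pi n z)), Rabs_minus_sym.
        apply rin_sub_le.
      + apply is_lim_seq_0_scal. now apply asym. }
  apply is_lim_seq_ext with (fun k => -1 * (rin (u k) y - rin (u k) z)).
  - intros k. rewrite y0, rin_zeror. ring.
  - now apply is_lim_seq_0_scal.
Qed.

Lemma mautner (n : G) (g h : nat -> G) x :
  (forall k, tg_mul n (g k) = tg_mul (g k) (h k)) ->
  is_lim_seq (fun k => tg_dist (h k) tg_one) 0 ->
  is_lim_seq (fun k => hdist (pi n (pi (g k) x)) (pi (g k) x)) 0.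
Proof.
  intros comm lim. apply act_strongly_continuous with (x := x) in lim. revert lim.
  apply is_lim_seq_ext. intros k.
  now rewrite act_one, <- act_mul, comm, act_mul, act_hdist.
Qed.

Lemma fixed_orthogonal_decomposition N x :
  subsemigroup N ->
  exists y z, x = hadd y z /\ fixed_by pi N y /\ orthogonal_to (fixed_by pi N) z.
Proof.
  intros semigroup. destruct (alaoglu_birkhoff N x semigroup) as (y & fy & hull_y).
  exists y, (hsub x y). split; [|split]; [|exact fy|].
  - apply rin_inj. intros v. rewrite rin_addl, rin_subl. ring.
  - intros v fv. rewrite rin_sym, rin_subr.
    rewrite (rin_closed_hull_orbit N x y v fv hull_y). ring.
Qed.

Lemma displacement_pythagoras (P : H -> Prop) g h y z :
  closed_subspace P -> (forall k v, P v -> P (pi k v)) -> tg_mul g h = tg_one ->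
  P y -> orthogonal_to P z ->
  (hdist (pi g (hadd y z)) (hadd y z))² = (hdist (pi g y) y)² + (hdist (pi g z) z)².
Proof.
  intros sub stable gh1 Py orth.
  assert (Pd : P (hsub (pi g y) y)).
  { apply (closed_subspace_add P sub); [|apply (closed_subspace_opp P)]; auto. }
  change ((hnorm (hsub (pi g (hadd y z)) (hadd y z)))²
    = (hnorm (hsub (pi g y) y))² + (hnorm (hsub (pi g z) z))²).
  replace (hsub (pi g (hadd y z)) (hadd y z))
    with (hadd (hsub (pi g y) y) (hsub (pi g z) z)).
  - rewrite !hnorm_sqr. apply pythagoras.
    rewrite rin_sym, rin_subl, (rin_act_inv g h) by assumption.
    rewrite !orth by auto. ring.
  - apply rin_inj. intros v. rewrite act_add, rin_addl, !rin_subl, !rin_addl. ring.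
Qed.

Section Subrepresentation.

Context {P : H -> Prop}.
Hypothesis sub : closed_subspace P.
Hypothesis stable : forall g v, P v -> P (pi g v).

Definition subrep_act g (v : subspace P sub) : subspace P sub :=
  exist _ (pi g (proj1_sig v)) (stable g _ (proj2_sig v)).

Lemma subrep_unitary :
  (forall g, exists h, tg_mul g h = tg_one) ->
  unitary_rep G (subspace P sub) subrep_act.
Proof.
  intros inv. destruct rep as (pi_add & pi_scal & pi_inner & _ & pi_mul & pi_one & pi_cont).
  refine (conj _ (conj _ (conj _ (conj _ (conj _ (conj _ _)))))).
  - intros g x y. apply proj1_sig_inj, pi_add.
  - intros g a x. apply proj1_sig_inj, pi_scal.
  - intros g x y. apply pi_inner.
  - intros g y. destruct (inv g) as [h gh1]. exists (subrep_act h y).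
    apply proj1_sig_inj. simpl. now rewrite <- pi_mul, gh1.
  - intros g h x. apply proj1_sig_inj, pi_mul.
  - intros x. apply proj1_sig_inj, pi_one.
  - intros x. apply pi_cont.
Qed.

End Subrepresentation.

End UnitaryRepresentation.

Canonical Radd_grp.
Canonical Aff_grp.

(** * Continuous homomorphisms *)

Record continuous_hom (G K : TopGrp) (phi : G -> K) : Prop := {
  continuous_hom_mul : forall g h, phi (tg_mul g h) = tg_mul (phi g) (phi h);
  continuous_hom_one : phi tg_one = tg_one;
  continuous_hom_cont : forall g0 eps, 0 < eps -> exists delta, 0 < delta /\
    forall g, tg_dist g g0 < delta -> tg_dist (phi g) (phi g0) < eps
}.

Lemma unitary_rep_pullback (G K : TopGrp) (phi : G -> K) (H : CHilbert)
  (pi : K -> H -> H) :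
  continuous_hom G K phi -> unitary_rep K H pi ->
  unitary_rep G H (fun g => pi (phi g)).
Proof.
  intros [phi_mul phi_one phi_cont]
    (pi_add & pi_scal & pi_inner & pi_surj & pi_mul & pi_one & pi_cont).
  refine (conj _ (conj _ (conj _ (conj _ (conj _ (conj _ _)))))); auto.
  - intros g h x. rewrite phi_mul. apply pi_mul.
  - intros x. rewrite phi_one. apply pi_one.
  - intros x g0 eps pos. destruct (pi_cont x (phi g0) eps pos) as (d & pos_d & near).
    destruct (phi_cont g0 d pos_d) as (d' & pos_d' & near').
    exists d'. split; [exact pos_d'|]. auto.
Qed.

Lemma Kazhdan_set_hom (G K : TopGrp) (phi : G -> K) (Q : G -> Prop) (Q' : K -> Prop) :
  continuous_hom G K phi -> (forall k, exists g, phi g = k) ->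
  (forall g, Q g -> Q' (phi g)) -> Kazhdan_set G Q -> Kazhdan_set K Q'.
Proof.
  intros hom surj incl (eps & pos & kazhdan). exists eps. split; [exact pos|].
  intros H pi rep x (c & c_ge0 & c_lt & moved).
  destruct (kazhdan H _ (unitary_rep_pullback G K phi H pi hom rep) x)
    as (v & nonzero & fixed).
  - exists c. auto.
  - exists v. split; [exact nonzero|]. intros k. destruct (surj k) as [g <-]. apply fixed.
Qed.

Lemma continuity_pt_delta (f : R -> R) (x : R) (eps : R) :
  continuity_pt f x -> 0 < eps -> exists delta, 0 < delta /\
    forall y, Rabs (y - x) < delta -> Rabs (f y - f x) < eps.
Proof.
  intros cont pos. apply continuity_pt_locally with (eps := mkposreal eps pos) in cont.
  destruct cont as [delta near]. exists delta. split; [apply cond_pos | exact near].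
Qed.

(** * Kazhdan sets of [R] are unbounded *)

Lemma sqrt_Cre_Cmul_conj (z : Cx) : sqrt (Cre (Cmul z (Cconj z))) = Cmod z.
Proof. unfold Cmod. f_equal. unfold Cre, Cmul, Cconj; simpl. ring. Qed.

Lemma Rabs_fst_le_Cmod (z : Cx) : Rabs (fst z) <= Cmod z.
Proof. apply Rle_trans with (2 := Rmax_Cmod z), Rmax_l. Qed.

Lemma Rabs_snd_le_Cmod (z : Cx) : Rabs (snd z) <= Cmod z.
Proof. apply Rle_trans with (2 := Rmax_Cmod z), Rmax_r. Qed.

Lemma Cmod_le_components (z : Cx) : Cmod z <= Rabs (fst z) + Rabs (snd z).
Proof.
  assert (re0 := Rabs_pos (fst z)). assert (im0 := Rabs_pos (snd z)).
  apply Rsqr_incr_0_var; [|lra]. unfold Cmod.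
  rewrite Rsqr_sqrt, Rsqr_plus, <- !Rsqr_abs by nra. unfold Rsqr. nra.
Qed.

Lemma Cx_complete (u : nat -> Cx) :
  (forall eps, 0 < eps -> exists N, forall m n, (N <= m)%nat -> (N <= n)%nat ->
     Cmod (Cminus (u m) (u n)) < eps) ->
  exists l, is_lim_seq (fun n => Cmod (Cminus (u n) l)) 0.
Proof.
  intros cauchy.
  assert (component : forall f : Cx -> R,
    (forall z w, Rabs (f z - f w) <= Cmod (Cminus z w)) ->
    exists l : R, is_lim_seq (fun n => Rabs (f (u n) - l)) 0).
  { intros f short. destruct (proj2 (ex_lim_seq_cauchy_corr (fun n => f (u n)))) as [l lim].
    - intros [eps pos]. destruct (cauchy eps pos) as [N near].
      exists N. intros n m le_n le_m.
      apply Rle_lt_trans with (1 := short _ _). now apply near.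
    - exists l. apply (proj1 (is_lim_seq_abs_0 (fun n => f (u n) - l))).
      rewrite <- (Rminus_diag l). apply is_lim_seq_minus'; [exact lim|].
      apply is_lim_seq_const. }
  destruct (component fst) as [a lim_a].
  { intros z w. exact (Rabs_fst_le_Cmod (Cminus z w)). }
  destruct (component snd) as [b lim_b].
  { intros z w. exact (Rabs_snd_le_Cmod (Cminus z w)). }
  exists (a, b).
  apply is_lim_seq_0_dominated with (fun n => Rabs (fst (u n) - a) + Rabs (snd (u n) - b)).
  - intros n. rewrite (Rabs_pos_eq _ (Cmod_ge_0 _)). apply Cmod_le_components.
  - rewrite <- (Rplus_0_l 0). now apply is_lim_seq_plus'.
Qed.

Ltac Cx_ring := intros; unfold Cadd, Cmul, Cconj, C0, C1, Cre in *; simpl; f_equal; ring.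

Definition Cx_hilbert : CHilbert.
Proof.
  unshelve refine
   {| hv := Cx; hadd := Cadd; hzero := C0; hopp := Copp;
      hscal := Cmul; hinner := fun z w => Cmul z (Cconj w) |};
    try solve [Cx_ring | intros [a b]; Cx_ring].
  - intros [a b]. unfold Cre, Cmul, Cconj; simpl. nra.
  - intros [a b]. unfold Cre, Cmul, Cconj, C0; simpl. intros norm0. f_equal; nra.
  - intros u cauchy. setoid_rewrite sqrt_Cre_Cmul_conj in cauchy.
    destruct (Cx_complete u cauchy) as [l lim]. exists l.
    setoid_rewrite sqrt_Cre_Cmul_conj. apply is_lim_seq_spec in lim.
    intros eps pos. destruct (lim (mkposreal eps pos)) as [N near]. exists N.
    intros n le_n. apply near, Rabs_lt_between in le_n. simpl in le_n.
    rewrite Rminus_0_r in le_n. apply le_n.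
Defined.

Lemma Rabs_sin_le (x : R) : Rabs (sin x) <= Rabs x.
Proof.
  assert (mean : Rabs (sin x - sin 0) <= 1 * Rabs (x - 0)).
  { apply bounded_variation with cos. intros t _. split.
    - apply is_derive_Reals, derivable_pt_lim_sin.
    - apply Rabs_le, COS_bound. }
  now rewrite sin_0, !Rminus_0_r, Rmult_1_l in mean.
Qed.

Definition rotation (t : R) (z : Cx_hilbert) : Cx_hilbert := Cmul (cos t, sin t) z.

Lemma rotation_rin (t t' : R) (z : Cx_hilbert) :
  rin (rotation t z) (rotation t' z) = cos (t - t') * rin z z.
Proof.
  rewrite cos_minus. unfold rin, rotation, Cre; cbn. unfold Cmul, Cconj; simpl. ring.
Qed.

Lemma rotation_hdist (t t' : R) (z : Cx_hilbert) :
  hdist (rotation t z) (rotation t' z) <= Rabs (t - t') * hnorm z.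
Proof.
  apply Rsqr_incr_0_var; [|apply Rmult_le_pos; [apply Rabs_pos | apply hnorm_ge0]].
  rewrite Rsqr_mult, hnorm_sqr, <- Rsqr_abs, hdist_sqr, !rotation_rin, !Rminus_diag, cos_0.
  assert (half : cos (t - t') = 1 - 2 * (sin ((t - t') / 2))²).
  { replace (t - t') with (2 * ((t - t') / 2)) at 1 by field.
    rewrite cos_2a_sin. unfold Rsqr. ring. }
  assert (small := Rsqr_le_abs_1 _ _ (Rabs_sin_le ((t - t') / 2))).
  assert (z_ge0 := rin_ge0 z). unfold Rsqr in *. nra.
Qed.

Lemma rotation_unitary : unitary_rep Radd_grp Cx_hilbert rotation.
Proof.
  assert (rotation_add : forall s t z, rotation (s + t) z = rotation s (rotation t z)).
  { intros s t z. unfold rotation. rewrite cos_plus, sin_plus. Cx_ring. }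
  assert (rotation_0 : forall z, rotation 0 z = z).
  { intros [a b]. unfold rotation. rewrite cos_0, sin_0. Cx_ring. }
  refine (conj _ (conj _ (conj _ (conj _ (conj _ (conj _ _)))))).
  - intros t x y. unfold rotation; cbn. Cx_ring.
  - intros t a x. unfold rotation; cbn. Cx_ring.
  - intros t x y. cbn. unfold rotation.
    transitivity (Cmul (Cmul (cos t, sin t) (Cconj (cos t, sin t))) (Cmul x (Cconj y))).
    { Cx_ring. }
    replace (Cmul (cos t, sin t) (Cconj (cos t, sin t))) with C1; [Cx_ring|].
    unfold C1. rewrite <- (sin2_cos2 t). unfold Rsqr. Cx_ring.
  - intros t y. exists (rotation (- t) y). rewrite <- rotation_add, Rplus_opp_r. apply rotation_0.
  - exact rotation_add.
  - exact rotation_0.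
  - intros z t0 eps pos. assert (z0 := hnorm_ge0 z).
    exists (eps / (hnorm z + 1)). split; [apply Rdiv_lt_0_compat; lra|].
    intros t near. apply Rle_lt_trans with (1 := rotation_hdist t t0 z).
    apply Rle_lt_trans with (Rabs (t - t0) * (hnorm z + 1)).
    + apply Rmult_le_compat_l; [apply Rabs_pos | lra].
    + apply Rlt_div_r; [lra | exact near].
Qed.

Lemma scaling_hom (s : R) : continuous_hom Radd_grp Radd_grp (Rmult s).
Proof.
  split.
  - intros g h. apply Rmult_plus_distr_l.
  - apply Rmult_0_r.
  - intros g0 eps pos. apply continuity_pt_delta; [|exact pos].
    exact (derivable_continuous_pt _ _ (derivable_pt_scal id s g0 (derivable_pt_id g0))).
Qed.

Lemma rotation_fixed_zero (s : R) (v : Cx_hilbert) :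
  s <> 0 -> (forall t, rotation (s * t) v = v) -> v = hzero.
Proof.
  intros nz fixed. specialize (fixed (PI / s)). revert fixed. unfold rotation.
  replace (s * (PI / s)) with PI by (field; lra). rewrite cos_PI, sin_PI.
  destruct v as [a b]. unfold Cmul; simpl. intros opp. injection opp as opp_a opp_b.
  cbn. unfold C0. f_equal; lra.
Qed.

Lemma bounded_not_Kazhdan (S : R -> Prop) (M : R) :
  (forall t, S t -> Rabs t <= M) -> ~ Kazhdan_set Radd_grp S.
Proof.
  intros bound (eps & pos & kazhdan).
  assert (M_le := Rle_abs M). assert (M_ge0 := Rabs_pos M).
  set (s := eps / (Rabs M + 1)).
  assert (s_pos : 0 < s) by (apply Rdiv_lt_0_compat; lra).
  assert (s_eq : s * Rabs M = eps - s) by (unfold s; field; lra).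
  assert (norm1 : hnorm (C1 : Cx_hilbert) = 1).
  { transitivity (Cmod C1); [apply sqrt_Cre_Cmul_conj | apply Cmod_1]. }
  destruct (kazhdan _ _
    (unitary_rep_pullback _ _ _ _ _ (scaling_hom s) rotation_unitary) (C1 : Cx_hilbert))
    as (v & nonzero & fixed).
  - exists (eps - s). rewrite norm1. split; [|split; [lra|]].
    + rewrite <- s_eq. apply Rmult_le_pos; lra.
    + intros t St. rewrite <- (act_one rotation_unitary (C1 : Cx_hilbert)) at 2.
      apply Rle_trans with (1 := rotation_hdist _ _ _).
      rewrite norm1, Rmult_1_r, <- s_eq. cbn. rewrite Rminus_0_r, Rabs_mult.
      rewrite (Rabs_pos_eq s) by lra. apply Rmult_le_compat_l; [lra|].
      specialize (bound t St). lra.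
  - apply nonzero, rotation_fixed_zero with s; [lra | exact fixed].
Qed.

Definition unbounded (S : R -> Prop) : Prop := forall M, exists t, S t /\ M <= Rabs t.

Lemma Kazhdan_unbounded (S : R -> Prop) : Kazhdan_set Radd_grp S -> unbounded S.
Proof.
  intros kazhdan M. apply NNPP. intros none.
  apply (bounded_not_Kazhdan S M); [|exact kazhdan].
  intros t St. apply Rlt_le, Rnot_le_lt. eauto.
Qed.

(** * The affine group *)

Definition ratio (g : Aff) : R := fst (proj1_sig g).
Definition offset (g : Aff) : R := snd (proj1_sig g).

Definition Aff_mk (a b : R) (a_pos : 0 < a) : Aff :=
  exist (fun p => 0 < fst p) (a, b) a_pos.
Definition transl (s : R) : Aff := Aff_mk 1 s Rlt_0_1.
Definition dilat (t : R) : Aff := Aff_mk (exp t) 0 (exp_pos t).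
Definition is_translation (g : Aff) : Prop := exists s, g = transl s.

Lemma ratio_gt0 (g : Aff) : 0 < ratio g.
Proof. exact (proj2_sig g). Qed.

Definition Aff_inv (g : Aff) : Aff :=
  Aff_mk (/ ratio g) (- offset g / ratio g) (Rinv_0_lt_compat _ (ratio_gt0 g)).

Lemma Aff_eq (g h : Aff) : ratio g = ratio h -> offset g = offset h -> g = h.
Proof. intros eq_a eq_b. now apply proj1_sig_inj, injective_projections. Qed.

Lemma ratio_mul (g h : Aff) : ratio (Aff_mul g h) = ratio g * ratio h.
Proof. now destruct g as [[a b] pa], h as [[a' b'] pa']. Qed.

Lemma offset_mul (g h : Aff) : offset (Aff_mul g h) = offset g + ratio g * offset h.
Proof. now destruct g as [[a b] pa], h as [[a' b'] pa']. Qed.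

Ltac Aff_solve :=
  apply Aff_eq; rewrite ?ratio_mul, ?offset_mul; cbn; try field.

Lemma Aff_mulV (g : Aff) : Aff_mul g (Aff_inv g) = Aff_one.
Proof. assert (pos := ratio_gt0 g). Aff_solve; lra. Qed.

Lemma transl_add (s t : R) : Aff_mul (transl s) (transl t) = transl (s + t).
Proof. Aff_solve. Qed.

Lemma transl_mul (s : R) (g : Aff) :
  Aff_mul (transl s) g = Aff_mul g (transl (s / ratio g)).
Proof. assert (pos := ratio_gt0 g). Aff_solve; lra. Qed.

Lemma Aff_decomp (g : Aff) (t : R) :
  ratio g = exp t -> g = Aff_mul (transl (offset g)) (dilat t).
Proof. intros eq_a. Aff_solve. rewrite eq_a. ring. Qed.

Lemma Aff_dist_eq (g h : Aff) :
  Aff_dist g h = sqrt ((ratio g - ratio h)² + (offset g - offset h)²).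
Proof. destruct g as [[a b] pa], h as [[a' b'] pa']. cbn. now rewrite !Rsqr_pow2. Qed.

Lemma Rabs_ratio_sub_le (g h : Aff) : Rabs (ratio g - ratio h) <= Aff_dist g h.
Proof.
  rewrite Aff_dist_eq, <- sqrt_Rsqr_abs. apply sqrt_le_1_alt.
  assert (pos := Rle_0_sqr (offset g - offset h)). lra.
Qed.

Lemma Aff_dist_transl_one (s : R) : Aff_dist (transl s) Aff_one = Rabs s.
Proof.
  rewrite Aff_dist_eq, <- sqrt_Rsqr_abs. f_equal. unfold Rsqr; cbn. ring.
Qed.

Lemma Aff_dist_dilat (s t : R) : Aff_dist (dilat s) (dilat t) = Rabs (exp s - exp t).
Proof.
  rewrite Aff_dist_eq, <- sqrt_Rsqr_abs. f_equal. unfold Rsqr; cbn. ring.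
Qed.

Lemma dilat_hom : continuous_hom Radd_grp Aff_grp dilat.
Proof.
  split.
  - intros s t. symmetry. Aff_solve. symmetry. apply exp_plus.
  - Aff_solve. apply exp_0.
  - intros t0 eps pos. cbn. setoid_rewrite Aff_dist_dilat.
    apply continuity_pt_delta; [|exact pos].
    apply derivable_continuous_pt, derivable_pt_exp.
Qed.

Lemma ln_ratio_hom : continuous_hom Aff_grp Radd_grp (fun g => ln (ratio g)).
Proof.
  split.
  - intros g h. cbn. rewrite ratio_mul. apply ln_mult; apply ratio_gt0.
  - apply ln_1.
  - intros g0 eps pos.
    destruct (continuity_pt_delta ln (ratio g0) eps) as (delta & pos' & near); auto.
    + apply derivable_continuous_pt. exists (/ ratio g0).
      apply derivable_pt_lim_ln, ratio_gt0.
    + exists delta. split; [exact pos'|]. intros g close. apply near.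
      apply Rle_lt_trans with (2 := close). apply Rabs_ratio_sub_le.
Qed.

Lemma is_translation_subsemigroup : subsemigroup is_translation.
Proof.
  split.
  - now exists (transl 0), 0.
  - intros n m [s ->] [t ->]. exists (s + t). apply transl_add.
Qed.

Lemma is_translation_normal : normal_set is_translation.
Proof.
  intros g n [s ->]. exists (transl (s / ratio g)). split; [now eexists | apply transl_mul].
Qed.

Definition transl_fixed {H : CHilbert} (pi : Aff -> H -> H) : H -> Prop :=
  fixed_by pi is_translation.

Section AffRepresentation.

Context {H : CHilbert} {pi : Aff -> H -> H}.
Hypothesis rep : unitary_rep Aff_grp H pi.

Lemma transl_fixed_closed_subspace : closed_subspace (transl_fixed pi).
Proof. apply (fixed_by_closed_subspace rep). Qed.

Lemma transl_fixed_stable (g : Aff) (v : H) : transl_fixed pi v -> transl_fixed pi (pi g v).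
Proof. apply (fixed_by_normal_stable rep). apply is_translation_normal. Qed.

Lemma transl_fixed_act (g : Aff) (t : R) (v : H) :
  ratio g = exp t -> transl_fixed pi v -> pi g v = pi (dilat t) v.
Proof.
  intros eq_t fv. rewrite (Aff_decomp g t eq_t), (act_mul rep).
  apply transl_fixed_stable; [exact fv | now eexists].
Qed.

Lemma transl_dilat_fixed (v : H) :
  transl_fixed pi v -> (forall t, pi (dilat t) v = v) -> forall g, pi g v = v.
Proof.
  intros fv dilat_v g. rewrite (transl_fixed_act g (ln (ratio g))); auto.
  symmetry. apply exp_ln, ratio_gt0.
Qed.

Definition transl_fixed_space : CHilbert :=
  subspace (transl_fixed pi) transl_fixed_closed_subspace.

Definition dilat_act : R -> transl_fixed_space -> transl_fixed_space :=
  subrep_act (pi := fun t => pi (dilat t))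
    transl_fixed_closed_subspace (fun t => transl_fixed_stable (dilat t)).

Lemma dilat_act_unitary : unitary_rep Radd_grp transl_fixed_space dilat_act.
Proof.
  apply subrep_unitary.
  - exact (unitary_rep_pullback _ _ _ _ _ dilat_hom rep).
  - intros t. exists (- t). apply Rplus_opp_r.
Qed.

Lemma large_ratio_asymptotically_fixed (g : nat -> Aff) (x : H) :
  is_lim_seq (fun k => ratio (g k)) p_infty ->
  asymptotically_fixed_by pi is_translation (fun k => pi (g k) x).
Proof.
  intros lim n [s ->].
  apply (mautner rep) with (h := fun k => transl (s / ratio (g k))).
  - intros k. apply transl_mul.
  - apply is_lim_seq_ext with (fun k => Rabs (s * / ratio (g k))).
    { intros k. symmetry. apply Aff_dist_transl_one. }
    apply (proj1 (is_lim_seq_abs_0 _)), is_lim_seq_0_scal.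
    now apply (is_lim_seq_inv _ p_infty).
Qed.

Lemma matrix_coefficient_lim (g : nat -> Aff) (x z : H) :
  orthogonal_to (transl_fixed pi) z -> is_lim_seq (fun k => ratio (g k)) p_infty ->
  is_lim_seq (fun k => rin (pi (g k) x) z) 0.
Proof.
  intros orth lim.
  apply (asymptotically_fixed_orthogonal rep is_translation (fun k => pi (g k) x)).
  - apply is_translation_subsemigroup.
  - exists (hnorm x). intros k. right. apply (act_hnorm rep).
  - now apply large_ratio_asymptotically_fixed.
  - exact orth.
Qed.

End AffRepresentation.

(* Inverses turn the elements of [Q] of small ratio into elements of large ratio. *)
Lemma unbounded_large_ratio_seq (Q : Aff -> Prop) :
  unbounded (Q0 Q) ->
  exists g : nat -> Aff,
    (forall n, Q (g n) \/ exists h, Q h /\ Aff_mul h (g n) = Aff_one) /\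
    is_lim_seq (fun n => ratio (g n)) p_infty.
Proof.
  intros unb.
  destruct (functional_choice (fun n g =>
    (Q g \/ exists h, Q h /\ Aff_mul h g = Aff_one) /\ INR n <= ratio g))
    as [g g_spec].
  - intros n. destruct (unb (INR n)) as (t & (h & Qh & eq_t) & large).
    change (ratio h = exp t) in eq_t.
    assert (grow := exp_ineq1_le (Rabs t)). revert large grow.
    unfold Rabs. destruct (Rcase_abs t); intros large grow.
    + exists (Aff_inv h). split; [right; exists h; auto using Aff_mulV|].
      cbn. rewrite eq_t, <- exp_Ropp. lra.
    + exists h. rewrite eq_t. split; [now left | lra].
  - exists g. split; [apply g_spec|].
    apply is_lim_seq_le_p_loc with INR; [|apply is_lim_seq_INR].
    exists 0%nat. intros n _. apply g_spec.
Qed.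

Lemma orthogonal_displacement_ge {H : CHilbert} (pi : Aff -> H -> H) (Q : Aff -> Prop)
  (z : H) (c : R) :
  unitary_rep Aff_grp H pi -> unbounded (Q0 Q) -> orthogonal_to (transl_fixed pi) z ->
  (forall g, Q g -> (hdist (pi g z) z)² <= c) -> 2 * rin z z <= c.
Proof.
  intros rep unb orth moved.
  destruct (unbounded_large_ratio_seq Q unb) as (g & Qg & lim_g).
  assert (coeff : forall n, 2 * rin z z - c <= 2 * rin (pi (g n) z) z).
  { intros n. destruct (Qg n) as [Qgn | (h & Qh & inv)].
    - specialize (moved _ Qgn). rewrite (displacement_sqr rep) in moved. lra.
    - specialize (moved _ Qh). rewrite (displacement_sqr rep) in moved.
      assert (adjoint := rin_act_inv rep h (g n) z z inv).
      rewrite (rin_sym z (pi (g n) z)) in adjoint. lra. }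
  assert (lim := is_lim_seq_0_scal 2 _ (matrix_coefficient_lim rep g z z orth lim_g)).
  assert (le := is_lim_seq_le _ _ _ _ coeff (is_lim_seq_const _) lim). simpl in le. lra.
Qed.

(** * The two implications *)

Lemma Kazhdan_Q0_of_Aff (Q : Aff -> Prop) :
  Kazhdan_set Aff_grp Q -> Kazhdan_set Radd_grp (Q0 Q).
Proof.
  apply (Kazhdan_set_hom _ _ _ _ _ ln_ratio_hom).
  - intros t. exists (dilat t). apply ln_exp.
  - intros g Qg. exists g. split; [exact Qg|]. symmetry. apply exp_ln, ratio_gt0.
Qed.

Lemma almost_invariant_fixed_component {H : CHilbert} (pi : Aff -> H -> H)
  (Q : Aff -> Prop) (x : H) (c : R) :
  unitary_rep Aff_grp H pi -> unbounded (Q0 Q) -> 0 <= c < hnorm x ->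
  (forall g, Q g -> hdist (pi g x) x <= c) ->
  exists y, transl_fixed pi y /\ hnorm x <= 2 * hnorm y /\
    forall g, Q g -> hdist (pi g y) y <= c.
Proof.
  intros rep unb [c_ge0 c_lt] moved.
  destruct (fixed_orthogonal_decomposition rep is_translation x
    is_translation_subsemigroup) as (y & z & -> & fy & orth).
  assert (split_moved : forall g, Q g ->
    (hdist (pi g y) y)² + (hdist (pi g z) z)² <= c²).
  { intros g Qg.
    rewrite <- (displacement_pythagoras rep (transl_fixed pi) g (Aff_inv g)); auto.
    - apply Rsqr_incr_1; auto using hdist_ge0.
    - apply (transl_fixed_closed_subspace rep).
    - apply (transl_fixed_stable rep).
    - apply Aff_mulV. }
  assert (small_z : 2 * rin z z <= c²).
  { apply (orthogonal_displacement_ge pi Q z c² rep unb orth). intros g Qg.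
    assert (y_ge0 := Rle_0_sqr (hdist (pi g y) y)). specialize (split_moved g Qg). lra. }
  exists y. split; [exact fy|split].
  - assert (norms := pythagoras y z). rewrite (rin_sym y), orth in norms by exact fy.
    specialize (norms eq_refl). rewrite <- !hnorm_sqr in *.
    apply Rsqr_incrst_1 in c_lt; [|exact c_ge0|apply hnorm_ge0].
    apply Rsqr_incr_0_var; [|assert (y_ge0 := hnorm_ge0 y); lra].
    rewrite Rsqr_mult. unfold Rsqr at 2. assert (y2_ge0 := Rle_0_sqr (hnorm y)). lra.
  - intros g Qg. apply Rsqr_incr_0_var; [|exact c_ge0].
    assert (z_ge0 := Rle_0_sqr (hdist (pi g z) z)). specialize (split_moved g Qg). lra.
Qed.

Lemma Kazhdan_Aff_of_Q0 (Q : Aff -> Prop) :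
  Kazhdan_set Radd_grp (Q0 Q) -> Kazhdan_set Aff_grp Q.
Proof.
  intros kazhdan. assert (unb := Kazhdan_unbounded _ kazhdan).
  destruct kazhdan as (eps & pos & invariant).
  exists (Rmin 1 (eps / 2)). split; [apply Rmin_glb_lt; lra|].
  intros H pi rep x (c & c_ge0 & c_lt & moved).
  assert (x_ge0 := hnorm_ge0 x).
  assert (c_lt1 : c < 1 * hnorm x).
  { apply Rlt_le_trans with (1 := c_lt), Rmult_le_compat_r; [exact x_ge0 | apply Rmin_l]. }
  assert (c_lt2 : c < eps / 2 * hnorm x).
  { apply Rlt_le_trans with (1 := c_lt), Rmult_le_compat_r; [exact x_ge0 | apply Rmin_r]. }
  destruct (almost_invariant_fixed_component pi Q x c) as (y & fy & large & moved_y); auto.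
  { lra. }
  destruct (invariant _ _ (dilat_act_unitary rep) (exist _ y fy)) as (v & nonzero & fixed).
  - exists c. split; [exact c_ge0|split].
    + change (c < eps * hnorm y). nra.
    + intros t (g & Qg & eq_t). change (hdist (pi (dilat t) y) y <= c).
      rewrite <- (transl_fixed_act rep g t y eq_t fy). auto.
  - exists (proj1_sig v). split.
    + intros v0. now apply nonzero, proj1_sig_inj.
    + apply (transl_dilat_fixed rep); [apply proj2_sig|].
      intros t. exact (f_equal (@proj1_sig _ _) (fixed t)).
Qed.

Theorem mainTheorem16 (Q : Aff -> Prop) :
  Kazhdan_set Aff_grp Q <-> Kazhdan_set Radd_grp (Q0 Q).
Proof. split; [apply Kazhdan_Q0_of_Aff | apply Kazhdan_Aff_of_Q0]. Qed.
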